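(* Let $p$ be a prime and let $G$ be a finite $p$-group such that $\mathrm{cod}(G)=\{1,p,p^b,p^a\}$, where $2\le b<a$. If $G$ has coclass at most $3$, then $G$ has nilpotence class at most $4$, and $|G|\le p^7$.
   Context: For an irreducible complex character $\chi$ of a finite group $G$, the codegree of $\chi$ is $\mathrm{cod}(\chi)=|G:\ker\chi|/\chi(1)$, and $\mathrm{cod}(G)$ denotes the set of codegrees of the irreducible characters of $G$. The coclass of a $p$-group $G$ of nilpotence class $c$ is $\log_p|G|-c$. *)

(* Defs.v *)
From mathcomp Require Import all_boot all_order all_algebra all_fingroup all_solvable all_field all_character.
Set Implicit Arguments. Unset Strict Implicit. Unset Printing Implicit Defensive.
Import GRing.Theory Num.Theory.
Local Open Scope ring_scope.

Definition codeg (gT : finGroupType) (G : {group gT}) (i : Iirr G) : algC :=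
  (#|G : cfker 'chi[G]_i|)%g%:R / 'chi[G]_i 1%g.

Definition in_cod (gT : finGroupType) (G : {group gT}) (x : algC) : Prop :=
  exists i : Iirr G, codeg i = x.

Definition coclass (p : nat) (gT : finGroupType) (G : {group gT}) : nat :=
  (logn p #|G| - nil_class G)%N.

(* Main.v *)
Require Import Defs.
From mathcomp Require Import all_boot all_order all_algebra all_fingroup all_solvable all_field all_character.
From mathcomp Require Import zify.
Import GRing.Theory Num.Theory.

(** Since |G| = p^(class + coclass), it is enough to bound the class by 4.
    If the class is at least 5, some quotient H of order p^n, n <= 8, has a
    faithful irreducible character and 'L_5(H) <> 1; a faithful irreducible
    character of degree p^f of a group of order p^m has codegree p^(m - f), with
    2f < m.  Likewise H has a class 3 quotient Q = H / K, K >= 'L_4(H), of order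
    p^m with m <= n - 2 <= 6, and a faithful irreducible character of degree
    p^f.  One finds |'L_3(Q)| = p, so a noncentral u in 'L_2(Q) has centraliser T
    of index p.  If |'L_2(Q)| = p^2 then Q has a nonabelian quotient of order
    p^3, whence b = 2; otherwise |Q| = p^6, |'L_2(Q)| = p^3 and Q has a nonabelian
    quotient of order p^4, whence b <= 3.  In both cases counting forces f = 1,
    |K| = p^2, hence K = 'L_4(H), and |Q : Q'| >= p^3.  As u is a noncentral
    element of the centre of T, a faithful character of degree p restricts
    reducibly to T, so T is abelian and |Q| <= p |'Z(Q)| |Q'|.  Finally
    'Z(Q) = 'L_3(Q) has order p because p-th powers of elements central modulo
    'L_4(H) are central modulo 'L_5(H), and |Q : Q'| <= p^2, a contradiction. *)

(** * Orders, commutators and centralisers in p-groups *)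

Section GroupTheory.
Local Open Scope group_scope.
Set Implicit Arguments.
Unset Strict Implicit.
Implicit Types (p n k : nat) (gT : finGroupType).

Definition lg p gT (A : {set gT}) := logn p #|A|.

Lemma card_lg p gT (G : {group gT}) : p.-group G -> #|G| = (p ^ lg p G)%N.
Proof. exact: card_pgroup. Qed.

Lemma lg_gt0 p gT (G : {group gT}) : p.-group G -> G :!=: 1 -> 0 < lg p G.
Proof.
move=> pG; rewrite lt0n; apply: contraNneq => lg0.
by rewrite trivg_card1 (card_lg pG) lg0.
Qed.

Lemma lg_prime p gT (A : {set gT}) : prime p -> #|A| = p -> lg p A = 1%N.
Proof. by move=> p_pr; rewrite /lg => ->; rewrite (logn_prime p p_pr) eqxx. Qed.

Lemma lgS p gT (A B : {group gT}) : A \subset B -> lg p A <= lg p B.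
Proof. exact: lognSg. Qed.

Lemma ltn_lg_proper p gT (A B : {group gT}) :
  p.-group B -> A \proper B -> lg p A < lg p B.
Proof. exact: properG_ltn_log. Qed.

Lemma lg_lcnS p gT (G : {group gT}) k :
  p.-group G -> 'L_k.+1(G) != 1 ->
  lg p ('L_k.+2(G)) < lg p ('L_k.+1(G)).
Proof.
move=> pG ntL.
apply: ltn_lg_proper; first exact: pgroupS (lcn_sub _ _) pG.
apply: (@nil_comm_properl _ G 'L_k.+1(G)%G G) => //; first exact: pgroup_nil pG.
  exact: lcn_sub.
by rewrite subsetI subxx lcn_norm.
Qed.

Lemma lg_quotient p gT (G N : {group gT}) :
  N <| G -> lg p G = lg p (G / N) + lg p N.
Proof.
move=> /andP[sNG nNG]; rewrite /lg card_quotient // -(Lagrange sNG) lognM //.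
by rewrite addnC.
Qed.

Lemma class_sub_lcoset gT (A M : {group gT}) u :
  (forall g, g \in M -> [~ u, g] \in A) -> u ^: M \subset u *: A.
Proof.
move=> cuA; apply/subsetP=> _ /imsetP[g Mg ->].
by rewrite mem_lcoset -commgEl cuA.
Qed.

(** Each [[~ z, g]] is central, so [[~ z ^+ n, g] = [~ z, g] ^+ n], which is trivial because the
    order of [A] divides [n]. *)
Lemma expg_center gT (G A : {group gT}) z n :
  A \subset 'Z(G) -> #|A| %| n -> z \in G ->
  (forall g, g \in G -> [~ z, g] \in A) -> z ^+ n \in 'Z(G).
Proof.
move=> sAZ An Gz cA; apply/centerP; split; first exact: groupX.
move=> g Gg; apply/commgP.
have ZA h : h \in A -> h \in 'Z(G) by apply/subsetP.
have Zzg: [~ z, g] \in 'Z(G) by rewrite ZA ?cA.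
rewrite commXg; last by have /centerP[_ cz] := Zzg; apply/commute_sym/cz.
by rewrite -order_dvdn (dvdn_trans _ An) // order_dvdG ?cA.
Qed.

(** The class of [u] lies in the coset [u *: A] of size [p]; its size is a power of [p], and is not
    1 because [u] is not central. *)
Lemma index_cent1_prime p gT (G A : {group gT}) u :
  prime p -> p.-group G -> #|A| = p -> u \in G -> u \notin 'Z(G) ->
  (forall g, g \in G -> [~ u, g] \in A) -> #|G : 'C_G[u]| = p.
Proof.
move=> p_pr pG oA Gu nZu cuA.
have le_p: #|G : 'C_G[u]| <= p.
  rewrite index_cent1 -oA -(card_lcoset A u).
  exact/subset_leq_card/class_sub_lcoset.
have /p_natP[k Dk]: p.-nat #|G : 'C_G[u]| by rewrite (pnat_dvd _ pG) ?dvdn_indexg.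
rewrite Dk in le_p *; case: k Dk le_p => [|[|k]] // Dk; last first.
  by rewrite -[in X in _ <= X](expn1 p) leq_exp2l // prime_gt1.
case/negP: nZu; apply/centerP; split=> // g Gg.
have: g \in 'C_G[u] by rewrite (index1g (subsetIl _ _) Dk).
by case/setIP=> _ /cent1P; apply: commute_sym.
Qed.

(** Take [x] in [G] outside [M]. What centralises [x] in [M] is centralised by both [M] and [x],
    hence by [G], and its index in [M] is the size of [x ^: M], at most the order of the derived
    subgroup. *)
Lemma lg_abelian_index_prime p gT (G M : {group gT}) :
  prime p -> p.-group G -> M \subset G -> abelian M -> #|G : M| = p ->
  lg p G <= 1 + lg p 'Z(G) + lg p (G^`(1)).
Proof.
move=> p_pr pG sMG cMM iM.
have maxM: maximal M G by apply: p_index_maximal; rewrite ?iM.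
have /properP[_ [x Gx nMx]] := maxgroupp maxM.
have sCZ: 'C_M[x] \subset 'Z(G).
  apply/subsetP=> y /setIP[My cxy]; have Gy := subsetP sMG y My.
  have prM: M \proper 'C_G[y].
    apply/properP; split; first by rewrite subsetI sMG sub_cent1 (subsetP cMM).
    by exists x; rewrite // inE Gx cent1C.
  have [/eqP defC | prC] := eqVproper (subsetIl G 'C[y]).
    apply/centerP; split=> // g; rewrite -{1}(eqP defC) => /setIP[_ /cent1P].
    exact: commute_sym.
  have [_ /(_ _ prC (proper_sub prM)) eqM] := maxgroupP maxM.
  by rewrite eqM properxx in prM.
have leM: #|M| <= #|'Z(G)| * #|G^`(1)|.
  rewrite -(Lagrange (subsetIl M 'C[x])) leq_mul ?subset_leq_card //.
  rewrite index_cent1 -(card_lcoset _ x) subset_leq_card //.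
  by apply: class_sub_lcoset => g Mg; rewrite mem_commg // (subsetP sMG).
have pZ := pgroupS (center_sub G) pG; have pG' := pgroupS (der_sub 1 G) pG.
rewrite -(leq_exp2l _ _ (prime_gt1 p_pr)) !expnD expn1.
rewrite -(card_lg pG) -(card_lg pZ) -(card_lg pG').
by rewrite -(Lagrange sMG) iM mulnC -mulnA leq_mul2l leM orbT.
Qed.

(** For nonabelian [G] the abelianisation is noncyclic of order at most p^2, so two elements [x],
    [y] generate [G]. The derived subgroup is then generated by the central [[~ x, y]], and its p-th
    power [[~ x ^+ p, y]] is trivial. *)
Lemma lg_der1_class2 p gT (G : {group gT}) :
  prime p -> p.-group G -> G^`(1) \subset 'Z(G) ->
  lg p G <= lg p (G^`(1)) + 2 -> lg p (G^`(1)) <= 1.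
Proof.
move=> p_pr pG sG'Z leG.
have [cGG | ncGG] := boolP (abelian G).
  by rewrite (derG1P cGG) /lg cards1 logn1.
have ncyc: ~~ cyclic (G / G^`(1)).
  apply: contra ncGG => /(cyclic_nilpotent_quo_der1_cyclic (pgroup_nil pG)).
  exact: cyclic_abelian.
have [sG'G nG'G] := andP (der_normal 1 G).
have [x Gx nG'x]: exists2 x, x \in G & x \notin G^`(1).
  apply/subsetPn; apply: contra ncyc => sGG'.
  by have /trivgP-> : G / G^`(1) \subset [1]; rewrite ?cyclic1 // quotient_sub1.
pose A := (<[x]> <*> G^`(1))%G.
have sAG: A \subset G by rewrite join_subG cycle_subG Gx.
have sG'A: G^`(1) \subset A by apply: joing_subr.
have Ax: x \in A by rewrite -cycle_subG joing_subl.
have nAG' : x \in 'N(G^`(1)) by apply: (subsetP nG'G).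
have [y Gy nAy]: exists2 y, y \in G & y \notin A.
  apply/subsetPn; apply: contra ncyc => sGA.
  suff: cyclic (A / G^`(1)) by apply: cyclicS; rewrite quotientS.
  have ->: A / G^`(1) = <[coset G^`(1) x]>.
    have nGx: <[x]> \subset 'N(G^`(1)) by rewrite cycle_subG.
    by rewrite -quotient_cycle // -(quotientYidr nGx).
  exact: cycle_cyclic.
have pA := pgroupS sAG pG.
have lt1: lg p (G^`(1)) < lg p A.
  by apply: ltn_lg_proper => //; apply/properP; split=> //; exists x.
pose B := (A <*> <[y]>)%G.
have sBG: B \subset G by rewrite join_subG cycle_subG Gy sAG.
have lt2: lg p A < lg p B.
  apply: ltn_lg_proper; first exact: pgroupS pG.
  by apply/properP; split; [apply: joing_subl|exists y; rewrite // -cycle_subG joing_subr].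
have leB: lg p B <= lg p G by apply: lgS.
have defB : B :=: G.
  apply/eqP; rewrite eqEcard sBG (card_lg pG) (card_lg (pgroupS sBG pG)).
  rewrite leq_exp2l ?prime_gt1 //; move: leG lt1 lt2; clear; lia.
have defG: <[x]> <*> <[y]> = G.
  rewrite -[_ <*> _]genGid; apply: Phi_nongen; apply/eqP.
  rewrite eqEsubset !join_subG Phi_sub !cycle_subG Gx Gy /=.
  have sG'P: G^`(1) \subset 'Phi(G) by rewrite (Phi_joing pG) joing_subl.
  apply: (@subset_trans _ _ B); first by rewrite defB.
  set R := _ <*> _; have sxyR: <[x]> <*> <[y]> \subset R by apply: joing_subr.
  have sPR: 'Phi(G) \subset R by apply: joing_subl.
  rewrite !join_subG (subset_trans sG'P sPR) andbT.
  by rewrite -join_subG.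
have xpG': x ^+ p \in G^`(1).
  have nsG'A: G^`(1) <| A by apply: normalS (der_normal 1 G).
  have lg1: lg p (A / G^`(1)) = 1%N.
    have eA : lg p A = lg p (A / G^`(1)) + lg p (G^`(1)).
      exact: lg_quotient nsG'A.
    by move: eA leG lt1 lt2 leB; clear; lia.
  rewrite coset_idr ?groupX // morphX //; apply/eqP; rewrite -order_dvdn.
  rewrite -[p in _ %| p]expn1 -[in X in _ %| X]lg1.
  by rewrite -(card_lg (quotient_pgroup _ pA)) order_dvdG ?mem_quotient.
have Zxy: [~ x, y] \in 'Z(G) by rewrite (subsetP sG'Z) // mem_commg.
have -> : G^`(1) = <[[~ x, y]]>.
  rewrite -{1}defG; apply: der1_joing_cycles.
  by rewrite defG; case/setIP: Zxy.
have: #[[~ x, y]] %| p.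
  rewrite order_dvdn -commXg; last by apply/commute_sym; have /centerP[_] := Zxy; apply.
  by apply/commgP; have /centerP[_] := subsetP sG'Z _ xpG'; apply.
move/(dvdn_leq_log p (prime_gt0 p_pr)).
by rewrite /lg -orderE (logn_prime p p_pr) eqxx.
Qed.

(** * The third and fourth terms of the lower central series *)

Lemma pgroup_lcn p gT (G : {group gT}) k : p.-group G -> p.-group 'L_k(G).
Proof. exact: pgroupS (lcn_sub k G). Qed.

Lemma lcn_last_center gT (G : {group gT}) k :
  'L_k.+2(G) = 1 -> 'L_k.+1(G) \subset 'Z(G).
Proof.
move=> L1; rewrite subsetI lcn_sub; apply/commG1P.
by rewrite -lcnSn.
Qed.

(* [w ^+ p] lies in ['L_3(G)], so [[w, g] ^+ p = [w ^+ p, g] = 1] for [w] in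
   ['L_2(G)]: the group ['L_3(G)] has exponent [p] inside a cyclic group. *)
Lemma lg_lcn3_cyclic_center p gT (G : {group gT}) :
  prime p -> p.-group G -> cyclic 'Z(G) -> 'L_4(G) = 1 ->
  lg p 'L_2(G) <= (lg p 'L_3(G)).+1 -> lg p 'L_3(G) <= 1.
Proof.
move=> p_pr pG cycZ L4 leL.
have L3Z : 'L_3(G) \subset 'Z(G) by apply: lcn_last_center.
have [-> | ntL3] := eqVneq 'L_3(G) 1; first by rewrite /lg cards1 logn1.
have ns32 : 'L_3(G) <| 'L_2(G) by apply: lcn_normalS.
have expL2 w : w \in 'L_2(G) -> w ^+ p \in 'L_3(G).
  move=> L2w; have nw: w \in 'N('L_3(G)) by apply: subsetP L2w; apply: normal_norm.
  rewrite coset_idr ?groupX // morphX //; apply/eqP; rewrite -order_dvdn.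
  have: #[coset 'L_3(G) w] %| #|'L_2(G) / 'L_3(G)|.
    by rewrite order_dvdG // mem_quotient.
  have eL : lg p 'L_2(G) = lg p ('L_2(G) / 'L_3(G)) + lg p 'L_3(G).
    exact: lg_quotient ns32.
  have lg1: lg p ('L_2(G) / 'L_3(G)) <= 1 by move: eL leL; clear; lia.
  move/dvdn_trans; apply; rewrite -[X in _ %| X]expn1.
  by rewrite (card_lg (quotient_pgroup _ (pgroup_lcn 2 pG))) dvdn_exp2l.
have pZ := pgroupS (center_sub G) pG.
have OhmZ x : x \in 'Z(G) -> x ^+ p = 1 -> x \in 'Ohm_1('Z(G)).
  move=> Zx xp; rewrite (OhmE 1 pZ) mem_gen // !inE expn1 xp eqxx andbT.
  by case/setIP: Zx => -> ->.
have sL3: 'L_3(G) \subset 'Ohm_1('Z(G)).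
  rewrite lcnSn gen_subG; apply/subsetP=> _ /imset2P[w g L2w Gg ->].
  have L3wg : [~ w, g] \in 'L_3(G) by rewrite lcnSn mem_commg.
  apply: OhmZ; first exact: subsetP L3Z _ _.
  rewrite -commXg; last first.
    have /centerP[_ cwg] := subsetP L3Z _ L3wg.
    by apply/commute_sym/cwg; apply: subsetP L2w; apply: lcn_sub.
  apply/eqP.
  by apply/commgP; have /centerP[_] := subsetP L3Z _ (expL2 w L2w); apply.
have ntZ: 'Z(G) != 1.
  by apply: contraNneq ntL3 => Z1; rewrite -subG1 -Z1.
have := lgS p sL3.
by rewrite (lg_prime p_pr (Ohm1_cyclic_pgroup_prime cycZ pZ ntZ)).
Qed.

Lemma coset_commg gT (G N : {group gT}) z g :
  G \subset 'N(N) -> z \in G -> g \in G ->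
  commute (coset N z) (coset N g) -> [~ z, g] \in N.
Proof.
move=> /subsetP nNG Gz Gg cc; rewrite coset_idr ?groupR ?nNG //.
by rewrite morphR ?nNG //; apply/eqP/commgP.
Qed.

(* If [z] generates the centre modulo ['L_4(G)], then [z ^+ p] is central
   modulo ['L_5(G)]; were ['L_3(G)] inside [<[z ^+ p]> 'L_4(G)], it would be
   central modulo ['L_5(G)] and ['L_4(G)] would be trivial. *)
Lemma center_quotient_lcn4 p gT (G : {group gT}) :
  prime p -> p.-group G -> lg p 'L_4(G) <= 2 -> 'L_5(G) != 1 ->
  cyclic 'Z(G / 'L_4(G)) -> 'Z(G / 'L_4(G)) \subset 'L_3(G) / 'L_4(G).
Proof.
move=> p_pr pG oL4 ntL5 /cyclicP[zb defZ].
have [sL4G nL4G] := andP (lcn_normal 4 G).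
have [_ nL5G] := andP (lcn_normal 5 G).
have Zzb: zb \in 'Z(G / 'L_4(G)) by rewrite defZ cycle_id.
have [z nz Gz /= Dzb] := morphimP (subsetP (center_sub _) _ Zzb).
have zG g : g \in G -> [~ z, g] \in 'L_4(G).
  move=> Gg; apply: (coset_commg nL4G) => //.
  have /centerP[_ cz] := Zzb; rewrite Dzb in cz.
  by apply: cz; rewrite mem_quotient.
have ntL4: 'L_4(G) != 1.
  by apply: contraNneq ntL5 => L4; rewrite -subG1 -L4 lcn_subS.
have ltL5 : lg p 'L_5(G) < lg p 'L_4(G) by apply: lg_lcnS.
have gt0L5: 0 < lg p 'L_5(G) by apply: lg_gt0 => //; apply: pgroup_lcn.
have eL : lg p 'L_4(G) = lg p ('L_4(G) / 'L_5(G)) + lg p 'L_5(G).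
  exact: lg_quotient (lcn_normalS 4 G).
have oA: #|'L_4(G) / 'L_5(G)| %| p.
  have lg1 : lg p ('L_4(G) / 'L_5(G)) <= 1 by move: eL gt0L5 oL4; clear; lia.
  rewrite (card_lg (quotient_pgroup _ (pgroup_lcn 4 pG))) -[X in _ %| X]expn1.
  by rewrite dvdn_exp2l.
have Zzp: coset 'L_5(G) (z ^+ p) \in 'Z(G / 'L_5(G)).
  rewrite morphX ?(subsetP nL5G) //.
  apply: expg_center (lcn_central 4 G) oA (mem_quotient _ Gz) _.
  move=> _ /morphimP[g ng Gg ->]; rewrite -morphR ?(subsetP nL5G) //.
  by rewrite mem_quotient // zG.
rewrite -[_ \subset _]negbK; apply/negP=> nsZ.
have sL3Z : 'L_3(G) / 'L_4(G) \subset <[zb]> by rewrite -defZ lcn_central.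
have /cyclicP[b Db] := cyclicS sL3Z (cycle_cyclic zb).
have /cycleP[i Di] : b \in <[zb]> by rewrite (subsetP sL3Z) // Db cycle_id.
(* Otherwise [zb ^+ i] would generate the whole centre, which would then equal
   ['L_3(G) / 'L_4(G)]. *)
have pi : p %| i.
  apply: contraR nsZ; rewrite -prime_coprime // => co_pi.
  rewrite defZ Db Di.
  suff /eqP-> : generator <[zb]> (zb ^+ i) by [].
  rewrite generator_coprime.
  have pzb : p.-elt zb by apply: mem_p_elt (quotient_pgroup _ pG) (subsetP (center_sub _) _ Zzb).
  have [k ->] := p_natP pzb.
  by rewrite coprimeXl.
(* Each [w] in ['L_3(G)] is a power of [z ^+ p] times an element of ['L_4(G)], and both factors are
   central modulo ['L_5(G)]. *)
have sL3: 'L_3(G) / 'L_5(G) \subset 'Z(G / 'L_5(G)).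
  apply/subsetP=> _ /morphimP[w nw L3w ->].
  have Gw : w \in G by apply: subsetP L3w; apply: lcn_sub.
  have: coset 'L_4(G) w \in <[b]> by rewrite -Db mem_quotient.
  case/cycleP=> j; have [k Dk] := dvdnP pi.
  rewrite Di Dzb -expgM Dk -(mulnC p) -mulnA expgM -!morphX ?groupX //.
  move/rcoset_kercosetP => /(_ (subsetP nL4G _ Gw) (groupX _ (groupX _ nz)))/rcosetP[h L4h ->].
  have nL5 := subsetP nL5G.
  have Gh : h \in G by apply: subsetP L4h; apply: lcn_sub.
  rewrite morphM ?nL5 ?groupX //= groupM //.
    by rewrite (subsetP (lcn_central 4 G)) ?mem_quotient.
  by rewrite morphX ?nL5 ?groupX.
suff sL45 : 'L_4(G) \subset 'L_5(G) by move: ltL5; rewrite ltnNge lgS.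
rewrite lcnSn gen_subG; apply/subsetP=> _ /imset2P[w g L3w Gg ->].
have Gw : w \in G by apply: subsetP L3w; apply: lcn_sub.
have /(subsetP sL3)/centerP[_ cw]: coset 'L_5(G) w \in 'L_3(G) / 'L_5(G).
  by rewrite mem_quotient.
by apply: (coset_commg nL5G) => //; apply: cw; rewrite mem_quotient.
Qed.

(* The quotient by the preimage of a maximal subgroup of Z(G / 'L_3(G)) that
   avoids 'L_2(G) / 'L_3(G). *)
Lemma nonabelian_quotient_lcn3 p gT (G : {group gT}) :
  prime p -> p.-group G -> 'L_4(G) = 1 -> #|'L_3(G)| = p ->
  lg p 'L_2(G) = 2 ->
  exists D : {group gT}, [/\ D <| G, ~~ abelian (G / D) & lg p (G / D) <= 3].
Proof.
move=> p_pr pG L4 oL3 oL2.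
have L3Z : 'L_3(G) \subset 'Z(G) by apply: lcn_last_center.
have lgL3 : lg p 'L_3(G) = 1%N by apply: lg_prime.
have [u L2u nZu]: exists2 u, u \in 'L_2(G) & u \notin 'Z(G).
  apply/subsetPn; apply/negP; rewrite subsetI => /andP[_ /commG1P L3].
  by have := prime_gt1 p_pr; rewrite -oL3 lcnSn L3 cards1.
have Gu: u \in G by apply: subsetP L2u; apply: lcn_sub.
have L3ug g : g \in G -> [~ u, g] \in 'L_3(G).
  by move=> Gg; rewrite lcnSn mem_commg.
have iT := index_cent1_prime p_pr pG oL3 Gu nZu L3ug.
set T := 'C_G[u]%G in iT.
have sTG : T \subset G by apply: subsetIl.
have nL3u: u \notin 'L_3(G) by apply: contra nZu; apply: subsetP.
(* ['L_3(G)] has index [p] in ['L_2(G)], so adjoining [u] already gives all of ['L_2(G)]. *)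
have L2_of (A : {group gT}) : 'L_3(G) \subset A -> A \subset 'L_2(G) -> 
    u \in A -> A :=: 'L_2(G).
  move=> sLA sAL Au.
  have pA := pgroupS sAL (pgroup_lcn 2 pG).
  have lt1 : lg p 'L_3(G) < lg p A.
    by apply: ltn_lg_proper => //; apply/properP; split=> //; exists u.
  apply/eqP; rewrite eqEcard sAL (card_lg pA) (card_lg (pgroup_lcn 2 pG)).
  by rewrite leq_exp2l ?prime_gt1 // oL2 -lgL3.
have cL2T : 'L_2(G) \subset 'C(T).
  rewrite -(L2_of ('L_2(G) :&: 'C(T))%G) ?subsetIr ?subsetIl //.
    by rewrite subsetI lcn_subS (subset_trans L3Z) // (subset_trans (subsetIr _ _)) ?centS.
  by rewrite inE L2u; apply/centP=> t /setIP[_ /cent1P/commute_sym].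
(* Three subgroups lemma: [[~: T, G]] lies in ['L_2(G)], which centralises [T], so [[~: T, T]]
   commutes with [G]. *)
have sTTZ : [~: T, T] \subset 'Z(G).
  rewrite subsetI comm_subG //=; apply/commG1P.
  have sTG2 : [~: T, G] \subset 'C(T) by apply: subset_trans cL2T; apply: commSg.
  by apply: three_subgroup; apply/commG1P; rewrite // commGC.
have sTTL3 : [~: T, T] \subset 'L_3(G).
  have sTTL2 : [~: T, T] \subset 'L_2(G) by rewrite lcn2 dergSn commgSS.
  have sZL2 : 'L_2(G) :&: 'Z(G) \subset 'L_3(G).
    have ltB : lg p ('L_2(G) :&: 'Z(G)) < lg p 'L_2(G).
      apply: ltn_lg_proper; first exact: pgroup_lcn.
      by apply/properP; split; [apply: subsetIl | exists u; rewrite // inE L2u].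
    have sL3B : 'L_3(G) \subset 'L_2(G) :&: 'Z(G) by rewrite subsetI lcn_subS.
    have pB : p.-group ('L_2(G) :&: 'Z(G)) by apply: pgroupS (subsetIl _ _) (pgroup_lcn 2 pG).
    suff: 'L_3(G) == 'L_2(G) :&: 'Z(G) by rewrite eqEsubset => /andP[].
    rewrite eqEcard sL3B oL3 (card_lg pB) -[X in _ <= X]expn1.
    by rewrite leq_exp2l ?prime_gt1 //; move: ltB; rewrite oL2.
  by rewrite (subset_trans _ sZL2) // subsetI sTTL2.
have nsL3 := lcn_normal 3 G; have [sL3G nL3G] := andP nsL3.
have sL3T : 'L_3(G) \subset T.
  rewrite subsetI sL3G sub_cent1 (subsetP _ u Gu) // centsC.
  by rewrite (subset_trans L3Z) ?subsetIr.
set N := 'L_3(G) in nsL3 sL3G nL3G sL3T *.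
have cTT : abelian (T / N) by apply: sub_der1_abelian.
have iTN : #|G / N : T / N| = p.
  by rewrite index_quotient_eq // subIset // sL3T orbT.
(* With the derived subgroup of [G / N] of order [p], this gives the centre of [G / N] index at most
   p^2. *)
have le_lg : lg p (G / N) <= 1 + lg p 'Z(G / N) + lg p ((G / N)^`(1)).
  have sTN := quotientS N sTG.
  exact: lg_abelian_index_prime p_pr (quotient_pgroup N pG) sTN cTT iTN.
have der1N : (G / N)^`(1) = 'L_2(G) / N by rewrite -quotient_der.
have lg1 : lg p ((G / N)^`(1)) = 1%N.
  have eL : lg p 'L_2(G) = lg p ('L_2(G) / N) + lg p N.
    exact: lg_quotient (lcn_normalS 2 G).
  have lgN : lg p N = 1%N by [].
  by rewrite der1N; move: eL lgN oL2; clear; lia.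
pose Z := 'Z(G / N).
have cZZ : abelian Z by apply: center_abelian.
have pZ : p.-group Z by apply: pgroupS (center_sub _) (quotient_pgroup N pG).
(* The Frattini subgroup of the abelian group [Z] consists of p-th powers. If [u] were x^p modulo
   [N] with [x] central modulo [N], then x^p, hence [u], would be central in [G]. *)
have nPu : coset N u \notin 'Phi(Z).
  rewrite (Phi_Mho pZ cZZ) (MhoEabelian 1 pZ cZZ).
  apply/imsetP=> [[xb Zxb]].
  have [x nx Gx /= Dxb] := morphimP (subsetP (center_sub _) _ Zxb).
  have xL3 g : g \in G -> [~ x, g] \in N.
    move=> Gg; apply: (coset_commg nL3G) => //.
    have /centerP[_ cx] := Zxb; rewrite Dxb in cx.
    by apply: cx; rewrite mem_quotient.
  have Zxp : x ^+ p \in 'Z(G) by apply: expg_center L3Z _ Gx xL3; rewrite oL3.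
  rewrite Dxb -morphX // expn1 => /rcoset_kercosetP.
  move=> /(_ (subsetP nL3G _ Gu) (groupX _ nx))/rcosetP[h L3h Du].
  by case/negP: nZu; rewrite Du groupM // (subsetP L3Z).
have Zu : coset N u \in Z.
  by rewrite (subsetP (lcn_central 2 G)) ?mem_quotient.
have [Db maxD nDu] : exists2 D : {group coset_of N}, maximal_eq D Z & coset N u \notin D.
  apply/exists_inP; apply: contraR nPu; rewrite negb_exists_in => /forall_inP allD.
  by apply/bigcapP=> D /allD; rewrite negbK.
have {}maxD : maximal Db Z.
  by case/predU1P: maxD nDu => // ->; rewrite Zu.
have iD := p_maximal_index pZ maxD.
have sDZ : Db \subset Z by apply: proper_sub (maxgroupp maxD).
have nsD : Db <| G / N by apply: sub_center_normal.
have [D defD sND nsDG] := inv_quotientN nsL3 nsD.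
exists D; split=> //.
  apply: contra nDu => cGD; rewrite defD mem_quotient //.
  by apply: subsetP L2u; apply: der1_min => //; apply: normal_norm.
have eG : lg p G = lg p (G / D) + lg p D by apply: lg_quotient.
have eGN : lg p G = lg p (G / N) + lg p N by apply: lg_quotient.
have eDN : lg p D = lg p Db + lg p N.
  by rewrite defD; apply: lg_quotient (normalS sND (normal_sub nsDG) nsL3).
have eZ : lg p Z = (lg p Db).+1.
  rewrite /lg -(Lagrange sDZ) iD lognM ?cardG_gt0 ?prime_gt0 //.
  by rewrite (logn_prime p p_pr) eqxx addn1.
move: eG eGN eDN eZ le_lg lg1; rewrite /Z; clear. lia.
Qed.
End GroupTheory.

(** * Codegrees and faithful irreducible characters *)

Section Codegrees.
Local Open Scope ring_scope.
Local Open Scope nat_scope.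
Local Open Scope group_scope.
Set Implicit Arguments.
Unset Strict Implicit.
Implicit Types (p n k : nat) (gT : finGroupType).

Lemma irr1_pgroup p gT (G : {group gT}) (i : Iirr G) :
  p.-group G -> exists f, 'chi_i 1 = (p ^ f)%N%:R%R.
Proof.
move=> pG; have := dvd_irr1_cardG i; rewrite irr1_degree dvdC_nat => dvd_n.
by have /p_natP[f ->] := pnat_dvd dvd_n pG; exists f.
Qed.

(** The square of the degree is at most the index of the centre of the character. That centre modulo
    the kernel is the centre of a nontrivial p-group, hence nontrivial, which makes [f.*2 < m]
    strict. *)
Lemma codeg_pgroup p gT (G : {group gT}) (i : Iirr G) m f :
  prime p -> p.-group G -> i != 0%R -> 'chi_i 1 = (p ^ f)%N%:R%R ->
  lg p (G / cfker 'chi_i) = m ->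
  f.*2 < m /\ codeg i = (p ^ (m - f))%N%:R%R.
Proof.
move=> p_pr pG nz_i Dchi1 <-; set K := cfker 'chi_i.
have nsKG : K <| G by apply: cfker_normal.
have sKZ : K \subset 'Z('chi_i)%CF by apply: normal_sub; apply: cfker_center_normal.
have nKG := normal_norm nsKG.
have iK : #|G : K| = (p ^ lg p (G / K))%N.
  by rewrite -card_quotient // (card_lg (quotient_pgroup K pG)).
have lt_f : f.*2 < lg p (G / K).
  have [le_sq _] := irr1_bound i; move: le_sq.
  rewrite Dchi1 -natrX ler_nat -expnM muln2 => le_sq.
  rewrite -(ltn_exp2l _ _ (prime_gt1 p_pr)) -iK.
  rewrite -(Lagrange_index (cfcenter_sub _) sKZ).
  apply: leq_ltn_trans le_sq _.
  rewrite -[X in X < _]muln1 ltn_pmul2l ?indexg_gt0 //.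
  rewrite -card_quotient ?(subset_trans (cfcenter_sub _)) //.
  rewrite cfcenter_eq_center cardG_gt1 (center_nil_eq1 (pgroup_nil (quotient_pgroup _ pG))).
  by rewrite -subG1 quotient_sub1 // subGcfker.
have le_f : f <= lg p (G / K) by move: lt_f; clear; lia.
split=> //; rewrite /codeg -/K iK Dchi1 -natf_div ?dvdn_exp2l //.
by rewrite expnB ?prime_gt0.
Qed.

Lemma in_cod_quotient gT (G N : {group gT}) x :
  N <| G -> in_cod (G / N)%G x -> in_cod G x.
Proof.
move=> nsNG [i <-]; exists (mod_Iirr i).
have nNG := normal_norm nsNG.
have sNK : N \subset cfker 'chi_(mod_Iirr i) by rewrite mod_IirrE // cfker_mod.
rewrite /codeg; congr (_%:R / _)%R; last by rewrite mod_IirrE // cfMod1.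
rewrite -(index_quotient_eq _ (cfker_sub _) nNG) ?subIset ?sNK ?orbT //.
by rewrite -cfker_quo // mod_IirrE // cfModK.
Qed.

(** [N] is the intersection of the kernels of the irreducible characters trivial on it, so one of
    these kernels does not contain [M]. *)
Lemma faithful_quotient gT (G M N : {group gT}) :
  N <| G -> ~~ (M \subset N) -> 
  exists K : {group gT}, [/\ K <| G, N \subset K, ~~ (M \subset K) &
    exists j : Iirr (G / K), cfaithful 'chi_j].
Proof.
move=> nsNG nsMN.
have [i sNK nsMK]: exists2 i, N \subset cfker 'chi[G]_i & ~~ (M \subset cfker 'chi_i).
  apply/exists_inP; apply: contraR nsMN; rewrite negb_exists_in => /forall_inP sMK.
  by rewrite -(cap_cfker_normal nsNG); apply/bigcapsP=> i /sMK; rewrite negbK.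
exists (cfker 'chi_i)%G; split=> //; first exact: cfker_normal.
exists (quo_Iirr (cfker 'chi_i) i).
by rewrite quo_IirrE ?cfker_normal // cfaithful_quo.
Qed.

(** Were the restriction to the centraliser irreducible, the element [u], central there, would act
    as a scalar and so be central in [G]. All constituents are therefore linear, and faithfulness
    kills the derived subgroup. *)
Lemma abelian_cent1_faithful p gT (G : {group gT}) (i : Iirr G) u :
  prime p -> p.-group G -> cfaithful 'chi_i -> 'chi_i 1 = p%:R%R ->
  u \in G -> u \notin 'Z(G) -> abelian 'C_G[u].
Proof.
move=> p_pr pG fful Dchi1 Gu nZu; set T := 'C_G[u]%G.
have sTG : T \subset G by apply: subsetIl.
have Tu : u \in T by rewrite inE Gu cent1id.
have ZTu : u \in 'Z(T).
  by apply/centerP; split=> // t /setIP[_ /cent1P/commute_sym].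
have Nres : 'Res[T] 'chi_i \is a character by rewrite cfRes_char ?irr_char.
have lin j : j \in irr_constt ('Res[T] 'chi_i) -> 'chi_j \is a linear_char.
  move=> Rj; have [f Df] := irr1_pgroup j (pgroupS sTG pG).
  have := char1_ge_constt Nres Rj; rewrite cfRes1 Dchi1 Df ler_nat => le_f.
  case: f Df le_f => [|[|f]] Df le_f.
  - by rewrite qualifE/= irr_char Df expn0 eqxx.
  - case/negP: nZu; rewrite -(cfcenter_fful_irr fful) irr_cfcenterE // Dchi1.
    have [chi' Nchi' Dres] := constt_charP j Nres Rj.
    have chi'1 : chi' 1 = 0%R.
      move/(congr1 (fun phi : 'CF(T) => phi 1)): Dres.
      rewrite cfRes1 cfunE Dchi1 Df expn1 => /eqP.
      by rewrite addrC -subr_eq subrr => /eqP.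
    have chi'0 : chi' = 0%R by apply/eqP; rewrite -char1_eq0 // chi'1.
    rewrite -(cfResE 'chi_i sTG Tu) Dres chi'0 addr0 -[p]expn1 -Df -irr_cfcenterE //.
    by move: ZTu; rewrite -cap_cfcenter_irr => /bigcapP; apply.
  - by move: le_f; rewrite -[X in _ <= X]expn1 leq_exp2l // prime_gt1.
apply/derG1P/trivgP.
have sTK : T^`(1) \subset cfker ('Res[T] 'chi_i).
  rewrite cfkerE // subsetI der_sub; apply/bigcapsP=> j /lin.
  by rewrite lin_irr_der1.
rewrite (subset_trans sTK) // cfker_Res ?irr_char // subIset //.
by apply/orP; right.
Qed.

(** Containment instead of equality with the set of codegrees, because containment passes to
    quotients. *)
Definition codegrees_in p a b gT (G : {group gT}) :=
  forall x, in_cod G x -> [\/ x = 1%R, x = p%:R%R, x = (p ^ b)%N%:R%R | x = (p ^ a)%N%:R%R].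

Lemma codegrees_in_quotient p a b gT (G N : {group gT}) :
  N <| G -> codegrees_in p a b G -> codegrees_in p a b (G / N)%G.
Proof. by move=> nsNG codG x /(in_cod_quotient nsNG)/codG. Qed.

Lemma codegrees_in_exp p a b gT (G : {group gT}) d :
  prime p -> codegrees_in p a b G -> in_cod G (p ^ d)%N%:R%R -> 2 <= d ->
  d = b \/ d = a.
Proof.
move=> p_pr codG /codG cod_d le2d.
have inj e : (p ^ d)%N%:R%R = (p ^ e)%N%:R%R :> algC -> d = e.
  by move/eqP; rewrite eqr_nat eqn_exp2l ?prime_gt1 // => /eqP.
case: cod_d; [move=> x1 | move=> xp | by left; apply: inj | by right; apply: inj].
  by have d0 : d = 0%N by [apply: inj; rewrite expn0]; rewrite d0 in le2d.
by have d1 : d = 1%N by [apply: inj; rewrite expn1]; rewrite d1 in le2d.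
Qed.

(** A nonlinear irreducible character of the quotient has codegree exponent [m - f] with [0 < f],
    [f.*2 < m] and [m <= k]. *)
Lemma codegrees_in_nonabelian_quotient p a b k gT (G D : {group gT}) :
  prime p -> p.-group G -> codegrees_in p a b G ->
  D <| G -> ~~ abelian (G / D) -> lg p (G / D) <= k ->
  exists d, [/\ 2 <= d, d < k & d = b \/ d = a].
Proof.
move=> p_pr pG codG nsDG ncGD leGD.
have [i nlin] : exists i : Iirr (G / D), 'chi_i \isn't a linear_char.
  apply/existsP; apply: contraR ncGD; rewrite negb_exists => /forallP lin.
  by apply/char_abelianP=> i; apply/negPn/lin.
have pGD := quotient_pgroup D pG.
have [f Df] := irr1_pgroup i pGD.
have nz_i : i != 0%R.
  by apply: contraNneq nlin => ->; rewrite irr0 cfun1_lin_char.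
pose m := lg p (G / D / cfker 'chi_i).
have [lt_f Dcod] := codeg_pgroup p_pr pGD nz_i Df (erefl m).
have gt0f : 0 < f.
  rewrite lt0n; apply: contraNneq nlin => f0.
  by rewrite qualifE/= irr_char Df f0 expn0 eqxx.
have le_m : m <= lg p (G / D).
  by rewrite (lg_quotient p (cfker_normal 'chi_i)) leq_addr.
exists (m - f); split.
- move: lt_f gt0f; clear; lia.
- move: lt_f gt0f le_m leGD; clear; lia.
apply: (codegrees_in_exp p_pr codG).
  by apply: in_cod_quotient nsDG _; exists i.
move: lt_f gt0f; clear; lia.
Qed.
Lemma quotient_lcn gT (G N : {group gT}) k :
  N <| G -> 'L_k(G / N) = 'L_k(G) / N.
Proof. by case/andP=> _ nNG; rewrite /quotient morphim_lcn. Qed.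

Lemma lg_der1_nonabelian p gT (G : {group gT}) :
  prime p -> p.-group G -> ~~ abelian G -> (lg p 'L_2(G)).+2 <= lg p G.
Proof.
move=> p_pr pG; apply: contraR => leG.
apply/cyclic_abelian/(cyclic_nilpotent_quo_der1_cyclic (pgroup_nil pG)).
have eG : lg p G = lg p (G / G^`(1)) + lg p 'L_2(G).
  exact: lg_quotient (der_normal 1 G).
have /= oQ := card_lg (quotient_pgroup G^`(1) pG).
have: lg p (G / G^`(1)) <= 1 by move: eG leG; clear; lia.
case Dl: (lg p _) oQ => [|[|l]] // oQ _; last by apply: prime_cyclic; rewrite oQ expn1.
by move/eqP: oQ; rewrite -trivg_card1 => /eqP->; apply: cyclic1.
Qed.

(** This is the class 2 bound applied to [G / 'L_3(G)]. *)
Lemma lg_lcn2_leq p gT (G : {group gT}) :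
  prime p -> p.-group G -> lg p G <= lg p 'L_2(G) + 2 ->
  lg p 'L_2(G) <= (lg p 'L_3(G)).+1.
Proof.
move=> p_pr pG leG; pose N := 'L_3(G); have nsN : N <| G by apply: lcn_normal.
have der1N : (G / N)^`(1) = 'L_2(G) / N by rewrite -quotient_der ?normal_norm.
have eG : lg p G = lg p (G / N) + lg p N by apply: lg_quotient.
have eL : lg p 'L_2(G) = lg p ('L_2(G) / N) + lg p N.
  exact: lg_quotient (lcn_normalS 2 G).
have leN : lg p (G / N) <= lg p ('L_2(G) / N) + 2 -> lg p ('L_2(G) / N) <= 1.
  rewrite -der1N; apply: lg_der1_class2 (quotient_pgroup N pG) _ => //=.
  by rewrite der1N; apply: lcn_central.
by rewrite -/N; move: leN eG eL leG; clear; lia.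
Qed.

Lemma faithful_codegree p a b gT (G : {group gT}) (i : Iirr G) :
  prime p -> p.-group G -> G :!=: 1 -> codegrees_in p a b G ->
  cfaithful 'chi_i ->
  exists f, [/\ 'chi_i 1 = (p ^ f)%N%:R%R, f.*2 < lg p G &
    2 <= lg p G - f -> lg p G - f = b \/ lg p G - f = a].
Proof.
move=> p_pr pG ntG codG fful; have [f Df] := irr1_pgroup i pG; exists f.
have nz_i : i != 0%R.
  apply: contraNneq ntG => i0; rewrite -subG1 -(cfker_irr0 G) -i0.
  exact: fful.
have oG : lg p (G / cfker 'chi_i) = lg p G.
  have lgK : lg p (cfker 'chi_i) = 0%N by rewrite (trivgP fful) /lg cards1 logn1.
  by rewrite [RHS](lg_quotient p (cfker_normal 'chi_i)) lgK addn0.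
have [lt_f Dcod] := codeg_pgroup p_pr pG nz_i Df oG.
split=> // le2; apply: (codegrees_in_exp p_pr codG) => //; by exists i.
Qed.

Lemma lcn_neq1_leq gT (G : {group gT}) k n :
  k <= n -> 'L_n(G) != 1 -> 'L_k(G) != 1.
Proof.
move=> le_kn; apply: contraNneq => Lk.
by rewrite -subG1 -Lk lcn_sub_leq.
Qed.

(** * The class bound in the presence of a faithful irreducible character *)

Lemma faithful_lcn5_eq1 p a b gT (G : {group gT}) (i : Iirr G) :
  prime p -> p.-group G -> 2 <= b -> b < a -> codegrees_in p a b G ->
  cfaithful 'chi_i -> lg p G <= 8 -> 'L_5(G) = 1.
Proof.
move=> p_pr pG le2b lt_ba codG fful leG8; apply/eqP; apply: contraT => ntL5.
have ntL k : k <= 5 -> 'L_k(G) != 1 by move/lcn_neq1_leq; apply.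
have gt0L5 : 0 < lg p 'L_5(G) by apply: lg_gt0 => //; apply: pgroup_lcn.
have ltL45 : lg p 'L_5(G) < lg p 'L_4(G) by apply: lg_lcnS; rewrite // ntL.
have nsML : ~~ ('L_3(G) \subset 'L_4(G)).
  have ltL34 : lg p 'L_4(G) < lg p 'L_3(G) by apply: lg_lcnS; rewrite // ntL.
  by apply/negP=> /(lgS p); rewrite leqNgt ltL34.
have [K [nsKG sL4K nsL3K [j fful_j]]] := faithful_quotient (lcn_normal 4 G) nsML.
set Q := (G / K)%G in j fful_j.
have pQ : p.-group Q by apply: quotient_pgroup.
have cycZ : cyclic 'Z(Q) by apply: irr_faithful_center fful_j.
have codQ : codegrees_in p a b Q by apply: codegrees_in_quotient codG.
have eG : lg p G = lg p Q + lg p K by apply: lg_quotient.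
have leK : lg p 'L_4(G) <= lg p K by apply: lgS.
have L4Q : 'L_4(Q) = 1.
  rewrite quotient_lcn //; apply/trivgP.
  by rewrite quotient_sub1 // (subset_trans (lcn_sub _ _)) ?normal_norm.
have ntL3Q : 'L_3(Q) != 1.
  rewrite quotient_lcn // -subG1 quotient_sub1 //.
  by rewrite (subset_trans (lcn_sub _ _)) ?normal_norm.
have ntLQ k : k <= 3 -> 'L_k(Q) != 1 by move/lcn_neq1_leq; apply.
have gt0L3 : 0 < lg p 'L_3(Q) by apply: lg_gt0 => //; apply: pgroup_lcn.
have ltL23 : lg p 'L_3(Q) < lg p 'L_2(Q) by apply: lg_lcnS; rewrite // ntLQ.
have ncQ : ~~ abelian Q by apply: contra (ntLQ 2 isT) => /derG1P/eqP.
have leQ := lg_der1_nonabelian p_pr pQ ncQ.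
have L3Z : 'L_3(Q) \subset 'Z(Q) by apply: lcn_last_center.
(* If ['L_3(Q)] has index above [p] in ['L_2(Q)], then [lg p Q] is at least [lg p 'L_3(Q) + 5],
   while it is at most 8 - 2 = 6. *)
have lgL3 : lg p 'L_3(Q) = 1%N.
  have h1 := lg_lcn3_cyclic_center p_pr pQ cycZ L4Q.
  have h2 := lg_lcn2_leq p_pr pQ.
  have [le_e2 | lt_e2] := leqP (lg p 'L_2(Q)) (lg p 'L_3(Q)).+1.
    by move: (h1 le_e2) gt0L3; clear; lia.
  by move: h2 lt_e2 leQ gt0L3 eG leK ltL45 gt0L5 leG8; clear; lia.
have oL3 : #|'L_3(Q)| = p by rewrite (card_lg (pgroup_lcn 3 pQ)) lgL3 expn1.
have [u L2u nZu]: exists2 u, u \in 'L_2(Q) & u \notin 'Z(Q).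
  apply/subsetPn; apply: contra ntL3Q; rewrite subsetI => /andP[_ /commG1P].
  by rewrite -lcnSn => ->.
have Qu: u \in Q by apply: subsetP L2u; apply: lcn_sub.
have L3ug g : g \in Q -> [~ u, g] \in 'L_3(Q).
  by move=> Qg; rewrite lcnSn mem_commg.
have iT := index_cent1_prime p_pr pQ oL3 Qu nZu L3ug.
have ntG : G :!=: 1 by apply: (ntL 1%N).
have ntQ : Q :!=: 1 by apply: (ntLQ 1%N).
have [f5 [_ lt_f5 d5]] := faithful_codegree p_pr pG ntG codG fful.
have [f [Df lt_f d3]] := faithful_codegree p_pr pQ ntQ codQ fful_j.
have gt0f : 0 < f.
  rewrite lt0n; apply: contra (ntLQ 2 isT) => /eqP f0.
  have lin : 'chi_j \is a linear_char by rewrite qualifE/= irr_char Df f0 expn0 eqxx.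
  by rewrite -subG1 (subset_trans (lin_char_der1 lin)).
(* In both cases the two faithful characters have codegree above p^b, hence equal to p^a, so
   [lg p K = f5 - f]. As [lg p K >= 2], [f >= 1] and [f5 <= 3], this forces [f = 1], [f5 = 3] and
   [lg p K = 2]; then [lg p G >= 7]. *)
have [f1 lgK ge3]: [/\ f = 1%N, lg p K = 2%N & lg p 'L_2(Q) + 3 <= lg p Q].
  have [e2 | lt_e2] := eqVneq (lg p 'L_2(Q)) 2.
    have [D [nsD ncD leD]] := nonabelian_quotient_lcn3 p_pr pQ L4Q oL3 e2.
    have [d [ge2 lt3 Dd]] := codegrees_in_nonabelian_quotient p_pr pQ codQ nsD ncD leD.
    split; move: le2b lt_ba leG8 gt0L5 ltL45 eG leK lgL3 leQ lt_f5 d5 lt_f d3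
      gt0f e2 ge2 lt3 Dd; clear; lia.
  have h2 := lg_lcn2_leq p_pr pQ.
  have e : lg p 'L_2(Q) = 3 /\ lg p Q = 6.
    by move: h2 lgL3 ltL23 lt_e2 leQ leG8 gt0L5 ltL45 eG leK; clear; lia.
  (* Since ['L_2(Q)] has order p^3, dividing by [R] leaves a nonabelian quotient of order p^4. *)
  have [R [sRL nsR oR]] : exists R : {group _}, [/\ R \subset 'L_2(Q), R <| Q & #|R| = (p ^ 2)%N].
    apply: normal_pgroup pQ (lcn_normal 2 Q) _.
    by have [e3 _] := e; rewrite /lg in e3; rewrite e3.
  have lgR : lg p R = 2 by rewrite /lg oR pfactorK.
  have ncR : ~~ abelian (Q / R).
    apply/negP=> /(der1_min (normal_norm nsR))/(lgS p).
    by have [e3 _] := e; rewrite lgR [lg p _]e3.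
  have eR : lg p Q = lg p (Q / R) + lg p R by apply: lg_quotient.
  have leR : lg p (Q / R) <= 4 by move: eR e lgR; clear; lia.
  have [d [ge2 lt4 Dd]] := codegrees_in_nonabelian_quotient p_pr pQ codQ nsR ncR leR.
  split; move: le2b lt_ba leG8 gt0L5 ltL45 eG leK lgL3 leQ lt_f5 d5 lt_f d3
    gt0f e ge2 lt4 Dd; clear; lia.
have leL4 : lg p 'L_4(G) <= 2 by move: leK; rewrite lgK.
have defK : 'L_4(G) = K.
  apply/eqP; rewrite eqEcard sL4K (card_lg (pgroup_lcn 4 pG)).
  rewrite (card_lg (pgroupS (normal_sub nsKG) pG)) leq_exp2l ?prime_gt1 // lgK.
  exact: leq_ltn_trans gt0L5 ltL45.
have sZL3 : cyclic 'Z(G / K) -> 'Z(G / K) \subset 'L_3(G) / K.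
  by rewrite -defK; apply: center_quotient_lcn4 p_pr pG leL4 ntL5.
have leZ : lg p 'Z(Q) <= lg p 'L_3(Q).
  by apply: lgS; rewrite /= quotient_lcn // sZL3.
have cTT : abelian 'C_Q[u].
  by rewrite f1 expn1 in Df; apply: abelian_cent1_faithful p_pr pQ fful_j Df Qu nZu.
(* The centre has order at most [p], so [lg p Q] is at most [lg p 'L_2(Q) + 2], against [ge3]. *)
have := lg_abelian_index_prime p_pr pQ (subsetIl _ _) cTT iT.
by rewrite -lcn2; move: leZ lgL3 ge3; clear; lia.
Qed.

(** Starting from ['L_k.+1(G)] the series drops strictly [d] times before becoming trivial. *)
Lemma nil_class_leq_lg_lcn p gT (G : {group gT}) k d :
  p.-group G -> (nil_class G = k + d)%N -> d <= lg p 'L_k.+1(G).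
Proof.
move=> pG; elim: d k => // d IHd k Dk.
have /IHd le_d : (nil_class G = k.+1 + d)%N by rewrite Dk addSnnS.
apply: leq_ltn_trans le_d (lg_lcnS pG _).
apply/eqP=> /(lcn_nil_classP _ (pgroup_nil pG)); rewrite Dk.
clear; lia.
Qed.
End Codegrees.

(** * Reduction to a faithful quotient of order at most p^8 *)

Theorem theorem1p2 (p a b : nat) (gT : finGroupType) (G : {group gT}) :
  prime p -> (p.-group G)%g ->
  (2 <= b)%N -> (b < a)%N ->
  (forall x : algC, in_cod G x <->
     [\/ x = 1%R, x = (p%:R)%R, x = ((p ^ b)%:R)%R | x = ((p ^ a)%:R)%R]) ->
  (coclass p G <= 3)%N ->
  (nil_class G <= 4)%N /\ (#|G| <= p ^ 7)%N.
Proof.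
move=> p_pr pG le2b lt_ba codG lecc.
have le4 : nil_class G <= 4.
  rewrite leqNgt; apply/negP=> gt4; rewrite -/(lg p G) in lecc.
  have codG' : codegrees_in p a b G by move=> x /codG.
  (* For class c, ['L_6(G)] has order at least p^(c - 5), while [lg p G] is at most c + 3; a
     quotient by [K] containing ['L_6(G)] thus has order at most p^8. *)
  have leL6 := @nil_class_leq_lg_lcn p _ G 5 (nil_class G - 5)%N pG (esym (subnKC gt4)).
  have ntL5 : 'L_5(G)%g != 1%g.
    by apply: contraTneq gt4 => /(lcn_nil_classP _ (pgroup_nil pG)); rewrite -leqNgt.
  have ltL : lg p 'L_6(G)%g < lg p 'L_5(G)%g by apply: lg_lcnS.
  have nsL : ~~ ('L_5(G)%g \subset 'L_6(G)%g).
    by apply/negP=> /(lgS p); rewrite leqNgt ltL.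
  have [K [nsK sLK nsLK [j fful]]] := faithful_quotient (lcn_normal 6 G) nsL.
  have eG : lg p G = lg p (G / K)%g + lg p K by apply: lg_quotient.
  have leK : lg p 'L_6(G)%g <= lg p K by apply: lgS.
  have le8 : lg p (G / K)%g <= 8.
    by move: eG leK leL6 gt4 lecc; rewrite /coclass -/(lg p G); clear; lia.
  have codK := codegrees_in_quotient nsK codG'.
  have pK := quotient_pgroup K pG.
  have L5 := faithful_lcn5_eq1 p_pr pK le2b lt_ba codK fful le8.
  case/negP: nsLK; rewrite -quotient_sub1 -?quotient_lcn ?L5 //.
  by rewrite (subset_trans (lcn_sub 5 G)) ?normal_norm.
(* The exponent 7 is class at most 4 plus coclass at most 3. *)
split=> //; rewrite (card_pgroup pG) leq_exp2l ?prime_gt1 //.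
by move: lecc le4; rewrite /coclass; clear; lia.
Qed.
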